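(* Let $V = X \oplus Y$ be a nonzero finite-dimensional complex symplectic vector space with $X, Y$ complementary Lagrangian subspaces, and let $G < \mathrm{GL}(X) < \mathrm{Sp}(V)$ be a finite subgroup. Then for all $v \in X^*$, $$h(\mathsf{HP}_0(\mathcal{O}_V^G, \mathcal{O}_V);t) \leq h((R_v, \deg_Y); t^2).$$ Thus the top degree of $\mathsf{HP}_0(\mathcal{O}_V^G, \mathcal{O}_V)$ is at most twice the top degree of $R_v$ in $Y$.
   Context: $\mathcal{O}_V = \mathrm{Sym}(V^* )$ is the algebra of polynomial functions on $V$, graded by polynomial degree, with the Poisson bracket induced by the symplectic form. $\mathsf{HP}_0(\mathcal{O}_V^G,\mathcal{O}_V) := \mathcal{O}_V/\{\mathcal{O}_V^G,\mathcal{O}_V\}$, where $\{\mathcal{O}_V^G,\mathcal{O}_V\}$ is the linear span of all $\{f,g\}$, $f\in\mathcal{O}_V^G$, $g\in\mathcal{O}_V$; it inherits the grading by total polynomial degree. The embedding $\mathrm{GL}(X) < \mathrm{Sp}(V)$ sends $A$ to $A \oplus (A^{-1})^*$, using $Y \cong X^*$ via the symplectic form. We write $V^* = X^* \oplus Y^*$ with $X^* = Y^\perp$ (functionals vanishing on $Y$) and $Y^* = X^\perp$. $\mathcal{O}_V$ is bigraded with $X^*$ in bidegree $(1,0)$ and $Y^*$ in bidegree $(0,1)$. For $v \in V^*$, let $v' \in V$ be the element corresponding to $v$ under the isomorphism $V^*\cong V$ given by the symplectic form, let $D_{v'}:\mathcal{O}_V\to\mathcal{O}_V$ be the directional derivative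 along $v'$, let $J_v \subseteq \mathcal{O}_V$ be the ideal generated by all $D_{v'}h$ with $h \in \mathcal{O}_V^G$, and let $R_v := \mathcal{O}_V/J_v$. For $v\in X^*$ the ideal $J_v$ is bihomogeneous, and $(R_v,\deg_Y)$ denotes $R_v$ graded by degree in the variables $Y^*$ only. For a graded vector space $K$, $h(K;t) = \sum_i \dim K_i\, t^i$; $\sum a_i t^i \le \sum b_i t^i$ means $a_i \le b_i$ for all $i$ (the value $\infty$ being allowed for $\dim K_i$). *)

(* Defs.v *)
From HB Require Import structures.
From mathcomp Require Import all_boot all_order all_algebra.
From mathcomp Require Import sesquilinear.

Set Implicit Arguments.
Unset Strict Implicit.
Unset Printing Implicit Defensive.

Import Order.TTheory GRing.Theory Num.Theory.
Local Open Scope ring_scope.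

(* The extended reals and {mpoly _[_]} have incompatible notations:
   the former are imported only inside this module. *)
Module HilbertSeries.
From mathcomp Require Import boolp classical_sets reals constructive_ereal ereal.
Local Open Scope classical_set_scope.
Local Open Scope ereal_scope.

Section Span.
Variables (F : fieldType) (M : lmodType F).
Implicit Types A N S : set M.

Definition span S : set M :=
  [set x | exists (n : nat) (a : 'I_n -> F) (s : 'I_n -> M),
    (forall i, S (s i)) /\ x = (\sum_(i < n) a i *: s i)%R].

Definition independent_mod N (n : nat) (f : 'I_n -> M) : Prop :=
  forall a : 'I_n -> F,
    N (\sum_(i < n) a i *: f i)%R -> forall i, a i = 0%R.

(* For subspaces A and N, the dimension (possibly +oo) of the image of A in
   the quotient space M / N. *)
Definition quotient_dim (R : realType) A N : \bar R :=
  ereal_sup [set d | exists (n : nat) (f : 'I_n -> M),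
    [/\ forall i, A (f i), independent_mod N f & d = n%:R%:E]].

(* The series h(M / N; t), where (M / N)_i is the image of A i. *)
Definition quotient_hilbert (R : realType) (A : nat -> set M) N :
  nat -> \bar R := fun i => quotient_dim R (A i) N.

End Span.

Section Series.
Variable R : realType.
Implicit Types h : nat -> \bar R.

Definition series_le h1 h2 : Prop := forall i, h1 i <= h2 i.

(* h(t) |-> h(t^2) *)
Definition series_sq h : nat -> \bar R :=
  fun i => if odd i then 0 else h i./2.

(* The top degree of the zero space is -oo; it is +oo if there are nonzero
   components of arbitrarily large degree. *)
Definition top_degree h : \bar R :=
  ereal_sup [set i%:R%:E | i in [set i : nat | h i != 0]].

End Series.
End HilbertSeries.
Export HilbertSeries.

From mathcomp Require Import boolp classical_sets reals mpoly.
Local Open Scope classical_set_scope.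

Definition ideal_generated (A : comNzRingType) (S : set A) : set A :=
  [set f | exists (n : nat) (a s : 'I_n -> A),
    (forall i, S (s i)) /\ f = \sum_(i < n) a i * s i].

Section PolynomialFunctions.
Variables (F : fieldType) (V : vectType F).

Definition dual : vectType F := 'Hom(V, F^o).

Definition annihilator (U : {vspace V}) : set dual :=
  [set xi | forall u, u \in U -> xi u = 0].

(* Sym(V^* ), with 'X_i standing for the i-th coordinate function of the
   basis vbasis {:V} of V. *)
Definition polyfun := {mpoly F[\dim {:V}]}.

Definition coordf (i : 'I_(\dim {:V})) : dual :=
  linfun (coord (vbasis {:V}) i : V -> F^o).

(* The inclusion of V^* in Sym(V^* ). *)
Definition linpoly (xi : dual) : polyfun :=
  \sum_(i < \dim {:V}) (xi (vbasis {:V})`_i : F) *: 'X_i.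

(* f |-> f \o g *)
Definition pullback (g : 'End(V)) (f : polyfun) : polyfun :=
  f \mPo [tuple linpoly (coordf i \o g)%VF | i < \dim {:V}].

Definition dirderiv (w : V) (f : polyfun) : polyfun :=
  \sum_(i < \dim {:V}) coord (vbasis {:V}) i w *: f^`M(i).

Definition total_degree (d : nat) : set polyfun := [set f | f \is d.-homog].

End PolynomialFunctions.

Section Symplectic.
Variables (F : fieldType) (V : vectType F) (omega : {skew_symmetric V}).

Definition flat : 'Hom(V, dual V) :=
  linfun (fun w : V => linfun (omega w : V -> F^o) : dual V).

(* xi |-> xi', i.e. omega xi' u = xi u for all u. *)
Definition sharp (xi : dual V) : V := (flat^-1)%VF xi.

(* The biderivation extending {xi, eta} = omega xi' eta' on V^*. *)
Definition poisson (f g : polyfun V) : polyfun V :=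
  \sum_(i < \dim {:V}) \sum_(j < \dim {:V})
    omega (sharp (coordf i)) (sharp (coordf j)) *: (f^`M(i) * g^`M(j)).

Definition lagrangian (X : {vspace V}) : Prop := orthov omega X = X.

End Symplectic.

Section LagrangianSplitting.
Variables (F : fieldType) (V : vectType F) (omega : {skew_symmetric V}).
Variables X Y : {vspace V}.

(* The map Y -> X^*, y |-> omega(-, y). *)
Definition pairing : 'Hom(subvs_of Y, dual (subvs_of X)) :=
  linfun (fun y => linfun (fun x => omega (vsval x) (vsval y) : F^o)
    : dual (subvs_of X)).

(* (A^-1)^* : phi |-> phi \o A^-1, transported from X^* to Y. *)
Definition contragredient (A : 'End(subvs_of X)) (y : subvs_of Y) :
  subvs_of Y := (pairing^-1)%VF (pairing y \o A^-1)%VF.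

(* A |-> A (+) (A^-1)^* on V = X (+) Y. *)
Definition GL_embed (A : 'End(subvs_of X)) : 'End(V) :=
  linfun (fun u : V =>
    vsval (A (vsproj X (daddv_pi X Y u)))
    + vsval (contragredient A (vsproj Y (daddv_pi Y X u)))).

(* The finite set of elements of G, as a subset of GL(X), is a subgroup. *)
Definition finite_subgroup_GL (G : seq 'End(subvs_of X)) : Prop :=
  [/\ \1%VF \in G,
      {in G &, forall A B, (A \o B)%VF \in G}
    & {in G, forall A, lker A = 0%VS /\ (A^-1)%VF \in G}].

Definition invariants (G : seq 'End(subvs_of X)) : set (polyfun V) :=
  [set f | forall A, A \in G -> pullback (GL_embed A) f = f].

(* Bidegree (p, q): p factors in X^* = annihilator Y, q in Y^* = annihilator X. *)
Definition bidegree (p q : nat) : set (polyfun V) :=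
  span [set m | exists (xi : 'I_p -> dual V) (eta : 'I_q -> dual V),
    [/\ forall i, annihilator Y (xi i), forall j, annihilator X (eta j)
      & m = (\prod_(i < p) linpoly (xi i)) * (\prod_(j < q) linpoly (eta j))]].

Definition degree_Y (q : nat) : set (polyfun V) :=
  span (\bigcup_p bidegree p q).

Variable G : seq 'End(subvs_of X).

Definition bracket_span : set (polyfun V) :=
  span [set poisson omega f g | f in invariants G & g in setT].

Definition J_ (v : dual V) : set (polyfun V) :=
  ideal_generated [set dirderiv (sharp omega v) h | h in invariants G].

(* h(HP_0(O_V^G, O_V); t) *)
Definition HP0_hilbert (R : realType) :=
  quotient_hilbert R (@total_degree F V) bracket_span.

(* h((R_v, deg_Y); t) *)
Definition R_Y_hilbert (R : realType) (v : dual V) :=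
  quotient_hilbert R degree_Y (J_ v).

End LagrangianSplitting.

(* Main.v *)
(* Let P and Q be the projections of V onto Y and X. The quadratic function
   E(u) = omega (Q u) (P u) is invariant and {E, f} = (q - p) f for f of bidegree
   (p, q), so HP_0 is concentrated in the bidegrees (q, q).

   In HP_0, let W_p be the image of v^(q - p) O_(p, q); these subspaces increase
   with p up to the whole bidegree (q, q) part, for p = q. For h invariant,
     {h, v^(k+1) a} = (k + 1) v^k a D_{v'} h + v^(k+1) {h, a},
   and the bracket {h, a} has X-degree one less than a D_{v'} h. Hence the
   multiplication by v^(q - p) maps J_v in bidegree (p, q) into W_(p-1), and
   dim W_p / W_(p-1) is at most the dimension of R_v in bidegree (p, q). Summing
   over p <= q gives the bound. *)
Require Import Defs.
From HB Require Import structures.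
From mathcomp Require Import all_boot all_order all_algebra sesquilinear complex.
From mathcomp Require mpoly boolp classical_sets.

Set Implicit Arguments.
Unset Strict Implicit.
Unset Printing Implicit Defensive.

Import Order.TTheory GRing.Theory Num.Theory HilbertSeries.

(* The notations of mpoly clash with those of the extended reals. *)
Module Polynomials.
Import boolp classical_sets mpoly.
Local Open Scope ring_scope.

(** * Homogeneous polynomials: induction principles, Euler's identity, graded components *)

Section MpolyInduction.
Variables (n : nat) (K : comNzRingType).
Implicit Types f g : {mpoly K[n]}.

(** A homogeneous polynomial is a combination of monomials of its own degree, and these are products
    of variables. The predicate carries the degree, so that degree-dependent claims can be checked
    on generators. *)
Lemma homog_ind (P : nat -> {mpoly K[n]} -> Prop) :
  P 0 1 -> (forall i, P 1 'X_i) ->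
  (forall d, P d 0) -> (forall d c f, P d f -> P d (c *: f)) ->
  (forall d f g, P d f -> P d g -> P d (f + g)) ->
  (forall d e f g, P d f -> P e g -> P (d + e)%N (f * g)) ->
  forall d f, f \is d.-homog -> P d f.
Proof.
move=> P1 PX P0 PZ PD PM d f /dhomogP hf; rewrite [f]mpolyE.
have PXn i k : P k ('X_i ^+ k).
  by elim: k => [|k ih]; rewrite ?expr0 // exprS -add1n; apply: PM.
have PXm m : P (mdeg m) 'X_[m].
  rewrite mpolyXE_id mdegE.
  by apply: (big_ind2 P) => // d1 f1 d2 f2; exact: PM.
rewrite big_seq; apply: (big_ind (P d)) => //; first exact: PD.
by move=> m /hf <-; apply: PZ; apply: PXm.
Qed.

Lemma mpoly_alg_ind (P : {mpoly K[n]} -> Prop) :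
  (forall c, P c%:MP) -> (forall i, P 'X_i) ->
  (forall f g, P f -> P g -> P (f + g)) ->
  (forall f g, P f -> P g -> P (f * g)) -> forall f, P f.
Proof.
move=> PC PX PD PM f.
rewrite (pihomog_partitionE (leqnn (mmeasure mdeg f))).
have P0 : P 0 by rewrite -mpolyC0; apply: PC.
have P1 : P 1 by rewrite -mpolyC1; apply: PC.
apply: (big_ind P) => // d _.
apply: (@homog_ind (fun _ => P) _ _ _ _ _ _ d _ (pihomogP _ _ _)) => //.
by move=> e c g Pg; rewrite -mul_mpolyC; apply: PM.
Qed.

(** The truncated predecessor is harmless at [d = 0]: the derivative is then zero, which is
    homogeneous of every degree. *)
Lemma dhomog_mderiv d i f : f \is d.-homog -> f^`M(i) \is d.-1.-homog.
Proof.
move=> hf; apply/dhomogP => m; rewrite mcoeff_msupp mcoeff_deriv => nz.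
have : f@_(m + U_(i)) != 0 by apply: contraNneq nz => ->; rewrite mul0rn.
rewrite -mcoeff_msupp => /(dhomogP _ _ _ hf) /=.
by rewrite mdegD mdeg1 addn1 => <-.
Qed.

Lemma mderiv_var (i j : 'I_n) : ('X_j : {mpoly K[n]})^`M(i) = (i == j)%:R.
Proof.
rewrite mderivX mnm1E eq_sym; have [->|_] := eqVneq i j; last by rewrite scale0r.
rewrite (_ : U_(j) - U_(j) = 0)%MM ?mpolyX0 ?scale1r //.
by apply/mnmP => k; rewrite mnmBE subnn mnm0E.
Qed.

Lemma var_mul_mderivM (i : 'I_n) f g :
  'X_i * (f * g)^`M(i) = 'X_i * f^`M(i) * g + f * ('X_i * g^`M(i)).
Proof. by rewrite mderivM mulrDr mulrA [f * _]mulrC -!mulrA [_ * f]mulrC. Qed.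

(** The Euler operator is a derivation that fixes every variable, so it acts on products of [d]
    variables as multiplication by [d]. *)
Lemma euler_identity d f : f \is d.-homog ->
  \sum_(i < n) 'X_i * f^`M(i) = d%:R *: f.
Proof.
move: d f; apply: homog_ind.
- by rewrite scale0r big1 // => i _; rewrite -mpolyC1 mderivC mulr0.
- move=> i.
  rewrite scale1r (bigD1 i) //= mderiv_var eqxx mulr1 big1 ?addr0 // => j ji.
  by rewrite mderiv_var (negPf ji) mulr0.
- by move=> d; rewrite scaler0 big1 // => i _; rewrite mderiv0 mulr0.
- move=> d c f ih; rewrite scalerA mulrC -scalerA -ih scaler_sumr.
  by apply: eq_bigr => i _; rewrite mderivZ scalerAr.
- move=> d f g ihf ihg; rewrite scalerDr -ihf -ihg -big_split.
  by apply: eq_bigr => i _; rewrite mderivD mulrDr.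
move=> d e f g ihf ihg; rewrite natrD scalerDl scalerAl -ihf scalerAr -ihg.
rewrite mulr_suml mulr_sumr -big_split; apply: eq_bigr => i _ /=.
exact: var_mul_mderivM.
Qed.

(** Multiplication by [f] shifts degrees by [e]. The case [d < e] has to be kept apart because
    [d - e] is truncated there. *)
Lemma pihomog_mull e d f g : f \is e.-homog ->
  pihomog mdeg d (f * g) = if (e <= d)%N then f * pihomog mdeg (d - e) g else 0.
Proof.
move=> hf; rewrite [g](pihomog_partitionE (leqnn (mmeasure mdeg g))).
pose P g := pihomog mdeg d (f * g) =
  if (e <= d)%N then f * pihomog mdeg (d - e) g else 0.
apply: (big_ind P) => [|g1 g2|i _]; rewrite /P.
- by rewrite mulr0 !linear0 mulr0 if_same.
- by rewrite mulrDr !linearD /= => -> ->; case: ifP; rewrite ?mulrDr ?addr0.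
have hg := pihomogP mdeg i g; have hfg := dhomogM hf hg.
case: leqP => [ed|ed]; last first.
  by rewrite (pihomog_ne0 _ hfg) // gtn_eqF // ltn_addr.
have [eqi|ne] := eqVneq (nat_of_ord i) (d - e)%N.
  rewrite -eqi pihomog_id pihomog_dE //.
  by rewrite -(subnKC ed) -eqi.
rewrite (pihomog_ne0 _ hfg) ?(pihomog_ne0 ne hg) ?mulr0 //.
by apply: contra ne => /eqP <-; rewrite addKn.
Qed.

End MpolyInduction.

(** [linfun] accepts an arbitrary function and agrees with it when that function is linear. Here
    linearity is a plain hypothesis, as needed for [flat], [pairing] and [GL_embed], which are built
    from bare functions. *)
Lemma linear_linfunE (K : fieldType) (U W : vectType K) (f : U -> W) :
  linear f -> linfun f =1 f.
Proof.
move=> lin_f.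
pose g : {linear U -> W} := HB.pack f (GRing.isLinear.Build K U W _ f lin_f).
exact: (lfunE g).
Qed.

(** * Linear forms as polynomials of degree one, and pullback along endomorphisms *)

Section LinearForms.
Variables (F : fieldType) (V : vectType F).
Implicit Types (xi eta : dual V) (u w : V) (f g : polyfun V).
Local Notation n := (\dim {:V}).
Local Notation b := (vbasis {:V}).

Lemma coordfE (i : 'I_n) u : coordf i u = coord b i u.
Proof. by apply: linear_linfunE => c x y; rewrite linearP. Qed.

Lemma coord_vbasisE (i j : 'I_n) : coord b i b`_j = (j == i)%:R.
Proof. by rewrite coord_free ?(basis_free (vbasisP _)). Qed.

Lemma coord_sum u : u = \sum_(i < n) coord b i u *: b`_i.
Proof. exact/coord_vbasis/memvf. Qed.

Lemma linpoly_linear : linear (@linpoly F V).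
Proof.
move=> c xi eta; rewrite /linpoly scaler_sumr -big_split; apply: eq_bigr => i _.
by rewrite /= !lfunE /= lfunE /= scalerA -scalerDl.
Qed.

HB.instance Definition _ :=
  GRing.isLinear.Build F (dual V) {mpoly F[n]} _ (@linpoly F V) linpoly_linear.

Lemma linpoly_coordf (i : 'I_n) : linpoly (coordf i) = 'X_i.
Proof.
rewrite /linpoly (bigD1 i) //= coordfE coord_vbasisE eqxx scale1r big1 ?addr0 //.
by move=> j ji; rewrite coordfE coord_vbasisE (negPf ji) scale0r.
Qed.

Lemma dual_coord_sum xi : xi = \sum_(i < n) (xi b`_i : F) *: coordf i.
Proof.
apply/lfunP => u; rewrite {1}[u]coord_sum linear_sum sum_lfunE.
by apply: eq_bigr => i _; rewrite linearZ /= lfunE /= coordfE /GRing.scale /= mulrC.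
Qed.

Lemma linpoly_homog xi : linpoly xi \is 1.-homog.
Proof.
by apply: rpred_sum => i _; apply: rpredZ; rewrite dhomogX; apply/eqP/mdeg1.
Qed.

Lemma mderiv_linpoly (i : 'I_n) xi : (linpoly xi)^`M(i) = (xi b`_i : F)%:MP.
Proof.
rewrite linear_sum (bigD1 i) //= mderivZ mderiv_var eqxx big1 ?addr0.
  by rewrite -mul_mpolyC mulr1.
by move=> j ji; rewrite mderivZ mderiv_var eq_sym (negPf ji) scaler0.
Qed.

Lemma pullbackM (g : 'End(V)) : {morph pullback g : f1 f2 / f1 * f2}.
Proof. by move=> f1 f2; rewrite /pullback rmorphM. Qed.

Lemma pullback_linear (g : 'End(V)) : linear (pullback g).
Proof. by move=> c f1 f2; rewrite /pullback linearP. Qed.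

HB.instance Definition _ (g : 'End(V)) :=
  GRing.isLinear.Build F {mpoly F[n]} {mpoly F[n]} _ (pullback g)
    (pullback_linear g).

Lemma pullbackX (g : 'End(V)) (i : 'I_n) :
  pullback g 'X_i = linpoly (coordf i \o g)%VF.
Proof. by rewrite /pullback comp_mpolyXU nth_mktuple. Qed.

Lemma pullbackC (g : 'End(V)) c : pullback g c%:MP = c%:MP.
Proof. exact: comp_mpolyC. Qed.

Lemma pullback_linpoly (g : 'End(V)) xi :
  pullback g (linpoly xi) = linpoly (xi \o g)%VF.
Proof.
rewrite {2}[xi]dual_coord_sum {1}/linpoly linear_sum.
have -> : ((\sum_(i < n) (xi b`_i : F) *: coordf i) \o g =
           \sum_(i < n) (xi b`_i : F) *: (coordf i \o g))%VF.
  apply/lfunP => u; rewrite comp_lfunE !sum_lfunE.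
  by apply: eq_bigr => i _; rewrite !scale_lfunE comp_lfunE.
by rewrite linear_sum; apply: eq_bigr => i _; rewrite !linearZ /= pullbackX.
Qed.

Lemma pullback_homog (g : 'End(V)) d f :
  f \is d.-homog -> pullback g f \is d.-homog.
Proof.
move: d f; apply: homog_ind => [|i|d|d c f|d f1 f2|d e f1 f2].
- by rewrite -mpolyC1 pullbackC mpolyC1 dhomog1.
- by rewrite pullbackX linpoly_homog.
- by rewrite linear0 dhomog0.
- by rewrite linearZ => /rpredZ ->.
- by rewrite linearD => /rpredD; apply.
by rewrite pullbackM; apply: dhomogM.
Qed.

(** A linear substitution preserves the degree of each component. Consequently the homogeneous
    components of an invariant are invariant. *)
Lemma pihomog_pullback (g : 'End(V)) d f :
  pihomog mdeg d (pullback g f) = pullback g (pihomog mdeg d f).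
Proof.
rewrite [f](pihomog_partitionE (leqnn (mmeasure mdeg f))).
pose P f := pihomog mdeg d (pullback g f) = pullback g (pihomog mdeg d f).
apply: (big_ind P) => [|f1 f2|i _]; rewrite /P.
- by rewrite !linear0.
- by rewrite !linearD /= => -> ->.
have hf := pihomogP mdeg i f; have hgf := pullback_homog g hf.
have [<-|ne] := eqVneq (nat_of_ord i) d.
  by rewrite pihomog_id (pihomog_dE hgf).
by rewrite (pihomog_ne0 ne hf) (pihomog_ne0 ne hgf) linear0.
Qed.

End LinearForms.

(** * Decomposition of a polynomial by its degree in the variables dual to [Y] *)

Lemma coef_affine (K : nzRingType) (a c : K) j :
  (a%:P * 'X + c%:P)`_j = if j == 0 then c else if j == 1 then a else 0.
Proof.
rewrite coefD coefMX !coefC.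
by case: j => [|[|j]] /=; rewrite ?add0r ?addr0.
Qed.

Section YDegree.
Variables (F : fieldType) (V : vectType F) (P Q : 'End(V)).
Hypothesis PQ : forall u, P u + Q u = u.
Implicit Types (xi : dual V) (f g : polyfun V).
Local Notation n := (\dim {:V}).

(** The substitution sending [f] to the function [f(t P u + Q u)] of [u], where [t] is the variable
    of the outer polynomial ring. When [P] and [Q] are the projections onto [Y] and [X], the
    coefficient of [t^j] is the component of degree [j] in the dual of [Y]. *)
Definition weight_mor : polyfun V -> {poly {mpoly F[n]}} :=
  mmap (polyC \o @mpolyC n F)
    (fun i => (linpoly (coordf i \o P)%VF)%:P * 'X
              + (linpoly (coordf i \o Q)%VF)%:P).

Lemma weight_mor_zmod : zmod_morphism weight_mor.
Proof. by move=> f g; rewrite /weight_mor raddfB. Qed.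

Lemma weight_mor_monoid : monoid_morphism weight_mor.
Proof.
by split=> [|f g]; rewrite /weight_mor ?rmorph1 ?rmorphM.
Qed.

HB.instance Definition _ := GRing.isZmodMorphism.Build
  {mpoly F[n]} {poly {mpoly F[n]}} weight_mor weight_mor_zmod.
HB.instance Definition _ := GRing.isMonoidMorphism.Build
  {mpoly F[n]} {poly {mpoly F[n]}} weight_mor weight_mor_monoid.

Definition weight_part (j : nat) f : polyfun V := (weight_mor f)`_j.

Lemma weight_morC c : weight_mor c%:MP = (c%:MP)%:P.
Proof. by rewrite /weight_mor mmapC. Qed.

Lemma weight_morX (i : 'I_n) : weight_mor 'X_i =
  (linpoly (coordf i \o P)%VF)%:P * 'X + (linpoly (coordf i \o Q)%VF)%:P.
Proof. by rewrite /weight_mor mmapX mmap1U. Qed.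

Lemma weight_morD (f g : {mpoly F[n]}) :
  weight_mor (f + g) = weight_mor f + weight_mor g.
Proof. exact: (rmorphD weight_mor). Qed.

Lemma weight_morM (f g : {mpoly F[n]}) :
  weight_mor (f * g) = weight_mor f * weight_mor g.
Proof. exact: (rmorphM weight_mor). Qed.

Lemma weight_partM j f g :
  weight_part j (f * g) =
  \sum_(i < j.+1) weight_part i f * weight_part (j - i) g.
Proof. by rewrite /weight_part weight_morM coefM. Qed.

(* Unification otherwise unfolds [weight_mor] down to [mmap] and diverges. *)
Opaque weight_mor.

Lemma weight_part_linear j : linear (weight_part j).
Proof.
move=> c f g; rewrite /weight_part -mul_mpolyC weight_morD weight_morM /= weight_morC.
by rewrite coefD coefCM mul_mpolyC.
Qed.

HB.instance Definition _ j :=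
  GRing.isLinear.Build F {mpoly F[n]} {mpoly F[n]} _ (weight_part j)
    (weight_part_linear j).


Lemma weight_partC j c : weight_part j c%:MP = if j == 0%N then c%:MP else 0.
Proof. by rewrite /weight_part weight_morC coefC. Qed.

Lemma linpoly_PQ xi : linpoly (xi \o P)%VF + linpoly (xi \o Q)%VF = linpoly xi.
Proof.
rewrite -linearD; congr linpoly; apply/lfunP => u.
by rewrite lfunE /= !comp_lfunE -linearD PQ.
Qed.

(** The sum of the coefficients is the value at [t = 1], where the substitution becomes the identity
    because [P + Q] is. *)
Lemma weight_part_sum f : f = \sum_(j < size (weight_mor f)) weight_part j f.
Proof.
have -> : \sum_(j < size (weight_mor f)) weight_part j f = (weight_mor f).[1].
  by rewrite horner_coef; apply: eq_bigr => j _; rewrite expr1n mulr1.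
apply/esym; move: f; apply: mpoly_alg_ind => [c|i|f g ihf ihg|f g ihf ihg].
- by rewrite weight_morC hornerC.
- by rewrite weight_morX !hornerE linpoly_PQ linpoly_coordf.
- by rewrite weight_morD hornerD; congr (_ + _).
by rewrite weight_morM hornerM; congr (_ * _).
Qed.

Lemma weight_mor_linpoly xi : weight_mor (linpoly xi) =
  (linpoly (xi \o P)%VF)%:P * 'X + (linpoly (xi \o Q)%VF)%:P.
Proof.
rewrite {1}/linpoly rmorph_sum /= -!pullback_linpoly /linpoly !linear_sum /=.
rewrite !rmorph_sum /= mulr_suml -big_split; apply: eq_bigr => i _ /=.
rewrite -mul_mpolyC weight_morM /= weight_morC weight_morX mulrDr mulrA.
by rewrite !pullbackM !pullbackC !pullbackX !polyCM.
Qed.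

Lemma weight_part_linpoly j xi : weight_part j (linpoly xi) =
  if j == 0%N then linpoly (xi \o Q)%VF
  else if j == 1%N then linpoly (xi \o P)%VF else 0.
Proof.
by rewrite /weight_part weight_mor_linpoly coef_affine.
Qed.

Lemma weight_part_mull (h : polyfun V) f j : weight_mor h = h%:P ->
  weight_part j (h * f) = h * weight_part j f.
Proof. by move=> hE; rewrite /weight_part weight_morM /= hE coefCM. Qed.

(** Such a form has degree 0 in [t]. It will be applied to [v], which vanishes on [Y], so that
    multiplication by powers of [v] commutes with taking parts. *)
Lemma weight_mor_linpoly_id xi : (xi \o P = 0)%VF ->
  weight_mor (linpoly xi) = (linpoly xi)%:P.
Proof.
move=> xiP; have := linpoly_PQ xi.
by rewrite weight_mor_linpoly xiP linear0 polyC0 mul0r !add0r => ->.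
Qed.

Lemma weight_part_homog j d f : f \is d.-homog -> weight_part j f \is d.-homog.
Proof.
move=> hf; move: d f hf j; 
apply: homog_ind => [|i|d|d c f ih|d f g ihf ihg|d e f g ihf ihg] j.
- by rewrite -mpolyC1 weight_partC; case: eqP; rewrite ?dhomog0 ?mpolyC1 ?dhomog1.
- rewrite -linpoly_coordf weight_part_linpoly.
  by do 2?case: eqP => _; rewrite ?dhomog0 ?linpoly_homog.
- by rewrite linear0 dhomog0.
- by rewrite linearZ; apply: rpredZ; apply: ih.
- by rewrite linearD; apply: rpredD; [apply: ihf|apply: ihg].
by rewrite weight_partM; apply: rpred_sum => i _; apply: dhomogM.
Qed.

End YDegree.

(** * Closure properties and induction for spans and generated ideals *)

Section SpanTheory.
Variables (F : fieldType) (M : lmodType F) (S : set M).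

Lemma mem_span x : S x -> span S x.
Proof.
by move=> Sx; exists 1, (fun=> 1), (fun=> x); rewrite big_ord1 scale1r.
Qed.

Lemma span0 : span S 0.
Proof.
by exists 0, (fun=> 0), (fun=> 0); rewrite big_ord0; split=> // -[].
Qed.

Lemma spanD x y : span S x -> span S y -> span S (x + y).
Proof.
move=> [n [a [s [Ss ->]]]] [m [b [t [St ->]]]].
exists (n + m)%N, (fun i => match split i with inl j => a j | inr j => b j end).
exists (fun i => match split i with inl j => s j | inr j => t j end).
split=> [i|]; first by case: split.
rewrite big_split_ord /=; congr (_ + _); apply: eq_bigr => i _.
  by rewrite (unsplitK (inl _ i)).
by rewrite (unsplitK (inr _ i)).
Qed.

Lemma spanZ c x : span S x -> span S (c *: x).
Proof.
move=> [n [a [s [Ss ->]]]]; exists n, (fun i => c * a i), s; split=> //.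
by rewrite scaler_sumr; apply: eq_bigr => i _; rewrite scalerA.
Qed.

Lemma spanB x y : span S x -> span S y -> span S (x - y).
Proof. by move=> Sx Sy; rewrite -scaleN1r; apply/spanD/spanZ. Qed.

Lemma span_sum (I : Type) (r : seq I) (P : pred I) (f : I -> M) :
  (forall i, P i -> span S (f i)) -> span S (\sum_(i <- r | P i) f i).
Proof.
by move=> Sf; apply: (big_ind (span S)) => //; [exact: span0|exact: spanD].
Qed.

Lemma span_ind (T : set M) : T 0 -> (forall x y, T x -> T y -> T (x + y)) ->
  (forall c x, T x -> T (c *: x)) -> (forall x, S x -> T x) ->
  forall x, span S x -> T x.
Proof.
move=> T0 TD TZ ST x [n [a [s [Ss ->]]]].
by apply: (big_ind T) => // i _; apply/TZ/ST.
Qed.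

End SpanTheory.

Section IdealTheory.
Variables (A : comNzRingType) (S : set A).

Lemma mem_ideal c x : S x -> ideal_generated S (c * x).
Proof. by move=> Sx; exists 1, (fun=> c), (fun=> x); rewrite big_ord1. Qed.

Lemma ideal0 : ideal_generated S 0.
Proof.
by exists 0, (fun=> 0), (fun=> 0); rewrite big_ord0; split=> // -[].
Qed.

Lemma idealD x y :
  ideal_generated S x -> ideal_generated S y -> ideal_generated S (x + y).
Proof.
move=> [n [a [s [Ss ->]]]] [m [b [t [St ->]]]].
exists (n + m)%N, (fun i => match split i with inl j => a j | inr j => b j end).
exists (fun i => match split i with inl j => s j | inr j => t j end).
split=> [i|]; first by case: split.
rewrite big_split_ord /=; congr (_ + _); apply: eq_bigr => i _.
  by rewrite (unsplitK (inl _ i)).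
by rewrite (unsplitK (inr _ i)).
Qed.

Lemma idealM c x : ideal_generated S x -> ideal_generated S (c * x).
Proof.
move=> [n [a [s [Ss ->]]]]; exists n, (fun i => c * a i), s; split=> //.
by rewrite mulr_sumr; apply: eq_bigr => i _; rewrite mulrA.
Qed.

Lemma ideal_sum (I : Type) (r : seq I) (P : pred I) (f : I -> A) :
  (forall i, P i -> ideal_generated S (f i)) ->
  ideal_generated S (\sum_(i <- r | P i) f i).
Proof.
by move=> Sf; apply: (big_ind (ideal_generated S)) => //;
  [exact: ideal0|exact: idealD].
Qed.

Lemma ideal_ind (T : set A) : T 0 -> (forall x y, T x -> T y -> T (x + y)) ->
  (forall c x, S x -> T (c * x)) -> forall x, ideal_generated S x -> T x.
Proof.
move=> T0 TD TM x [n [a [s [Ss ->]]]].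
by apply: (big_ind T) => // i _; apply: TM.
Qed.

End IdealTheory.

(** * Linear independence modulo a subspace *)

Section RankSplit.
Variables (F : fieldType) (M : lmodType F) (N : set M).
Hypotheses (N0 : N 0) (ND : forall x y, N x -> N y -> N (x + y))
  (NZ : forall c x, N x -> N (c *: x)).

Lemma lin_comb_mulmx m n (A : 'M[F]_(m, n)) (f : 'I_n -> M) (a : 'I_m -> F) :
  \sum_(i < m) a i *: (\sum_(j < n) A i j *: f j) =
  \sum_(j < n) (\row_i a i *m A) 0 j *: f j.
Proof.
under eq_bigr do rewrite scaler_sumr.
rewrite exchange_big; apply: eq_bigr => j _; rewrite mxE scaler_suml.
by apply: eq_bigr => i _; rewrite mxE scalerA.
Qed.

Lemma independent_mod_mx m n (A : 'M[F]_(m, n)) (f : 'I_n -> M) :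
  row_free A -> independent_mod N f ->
  independent_mod N (fun i => \sum_(j < n) A i j *: f j).
Proof.
move=> freeA indf a; rewrite lin_comb_mulmx => /indf aA0 i.
have /(row_free_inj freeA) /rowP/(_ i) : \row_i a i *m A = 0 *m A.
  by rewrite mul0mx; apply/rowP => j; rewrite aA0 mxE.
by rewrite !mxE.
Qed.

(** The coefficient vectors sent into [N] form the kernel of a linear map from [F^n] to [M / N]. The
    rows of [B] are a basis of this kernel and the rows of [A] a basis of a complement. *)
Lemma rank_split n (f : 'I_n -> M) :
  exists r s (A : 'M[F]_(r, n)) (B : 'M[F]_(s, n)),
  [/\ (r + s)%N = n, row_free A, row_free B,
      independent_mod N (fun i => \sum_(j < n) A i j *: f j)
    & forall i, N (\sum_(j < n) B i j *: f j)].
Proof.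
pose ev (u : 'rV[F]_n) := \sum_(j < n) u 0 j *: f j.
have evD u w : ev (u + w) = ev u + ev w.
  by rewrite /ev -big_split; apply: eq_bigr => j _; rewrite mxE scalerDl.
have evZ c u : ev (c *: u) = c *: ev u.
  by rewrite /ev scaler_sumr; apply: eq_bigr => j _; rewrite mxE scalerA.
have ev_sum m (A : 'M[F]_(m, n)) (u : 'rV_m) :
    ev (u *m A) = \sum_i u 0 i *: ev (row i A).
  rewrite mulmx_sum_row; elim/big_ind2: _ => [|x1 x2 y1 y2 <- <-|i _] //.
  by rewrite /ev big1 // => j _; rewrite mxE scale0r.
pose Kp (U : 'M[F]_n) := forall i, N (ev (row i U)).
have KpP U : Kp U -> forall u, (u <= U)%MS -> N (ev u).
  move=> KU u /submxP [w ->]; rewrite ev_sum.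
  by apply: (big_ind N) => // i _; apply: NZ.
have Kmx m (A : 'M[F]_(m, n)) :
    (forall i, N (ev (row i A))) -> Kp <<A>>%MS.
  move=> KA i; have : (row i <<A>> <= A)%MS.
    by rewrite -(genmxE A) row_sub.
  move=> /submxP [w ->]; rewrite ev_sum.
  by apply: (big_ind N) => // j _; apply: NZ.
(* The kernel is obtained as a row space of maximal rank among those that [ev] maps into [N]. *)
pose p k := `[< exists U, Kp U /\ \rank U = k >].
have ex_p : exists k, p k.
  exists 0; apply/asboolP; exists 0; rewrite mxrank0; split=> // i.
  by rewrite row0 /ev big1 // => j _; rewrite mxE scale0r.
have p_le k : p k -> (k <= n)%N by move=> /asboolP [U [_ <-]]; exact: rank_leq_row.
case: (ex_maxnP ex_p p_le) => k /asboolP [U [KU rkU]] maxk.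
(* Adjoining [u] as a further row keeps the image in [N], so by maximality it cannot raise the
   rank. *)
have maxU u : N (ev u) -> (u <= U)%MS.
  move=> Nu; have KUu : Kp <<col_mx U u>>%MS.
    apply: Kmx => i; case: (splitP i) => j ij.
      by rewrite (_ : i = lshift 1 j) ?rowKu //; apply: val_inj.
    by rewrite (_ : i = rshift n j) ?rowKd ?row_id //; apply: val_inj.
  have : p (\rank <<col_mx U u>>%MS) by apply/asboolP; exists <<col_mx U u>>%MS.
  move=> /maxk; rewrite -rkU genmxE -addsmxE => le.
  have := geq_leqif (mxrank_leqif_sup (addsmxSl U u)).
  by rewrite le addsmx_sub => /esym/andP [].
exists (\rank U^C)%MS, (\rank U), (row_base U^C)%MS, (row_base U).
split; rewrite ?row_base_free //.
- by rewrite mxrank_compl subnK // rank_leq_row.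
- move=> a; rewrite lin_comb_mulmx => /maxU aU i.
  set w := \row_i a i in aU.
  have : (w *m row_base U^C <= U :&: U^C)%MS.
    by rewrite sub_capmx aU mulmx_sub // eq_row_base.
  rewrite capmx_compl submx0 => /eqP w0.
  have /rowP/(_ i) : w = 0.
    by apply: (row_free_inj (row_base_free U^C%MS)); rewrite w0 mul0mx.
  by rewrite !mxE.
move=> i; have /(KpP _ KU) : (row i (row_base U) <= U)%MS.
  by rewrite -(eq_row_base U) row_sub.
by rewrite /ev; under eq_bigr do rewrite mxE.
Qed.

End RankSplit.

(** * Directional derivatives and the Poisson bracket *)

Section DirectionalDerivative.
Variables (F : fieldType) (V : vectType F).
Implicit Types (w : V) (f g : {mpoly F[\dim {:V}]}).
Local Notation n := (\dim {:V}).

Lemma dirderiv_linear w : linear (dirderiv w).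
Proof.
move=> c f g; rewrite /dirderiv scaler_sumr -big_split; apply: eq_bigr => i _.
by rewrite /= mderivD mderivZ scalerDr !scalerA mulrC.
Qed.

HB.instance Definition _ w :=
  GRing.isLinear.Build F {mpoly F[n]} {mpoly F[n]} _ (dirderiv w)
    (dirderiv_linear w).

Lemma dirderivM w f g : dirderiv w (f * g) = dirderiv w f * g + f * dirderiv w g.
Proof.
rewrite /dirderiv mulr_suml mulr_sumr -big_split; apply: eq_bigr => i _.
by rewrite /= mderivM scalerDr scalerAl scalerAr.
Qed.

Lemma dirderiv_homog w d f : f \is d.-homog -> dirderiv w f \is d.-1.-homog.
Proof. by move=> hf; apply: rpred_sum => i _; apply/rpredZ/dhomog_mderiv. Qed.

Lemma dirderivX w (i : 'I_n) : dirderiv w 'X_i = (coordf i w : F)%:MP.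
Proof.
rewrite /dirderiv (bigD1 i) //= mderiv_var eqxx big1 ?addr0.
  by rewrite -mul_mpolyC mulr1 coordfE.
by move=> j ji; rewrite mderiv_var (negPf ji) scaler0.
Qed.

End DirectionalDerivative.

Section Poisson.
Variables (F : fieldType) (V : vectType F) (omega : {skew_symmetric V}).
Implicit Types (f g h : {mpoly F[\dim {:V}]}) (xi : dual V).
Local Notation n := (\dim {:V}).
Local Notation b := (vbasis {:V}).
Local Notation "{{ f , g }}" := (poisson omega f g).

Lemma poisson_linearr f : linear (poisson omega f).
Proof.
move=> c g h; rewrite /poisson scaler_sumr -big_split; apply: eq_bigr => i _ /=.
rewrite scaler_sumr -big_split; apply: eq_bigr => j _ /=.
by rewrite mderivD mderivZ mulrDr scalerDr -scalerAr !scalerA mulrC.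
Qed.

HB.instance Definition _ f :=
  GRing.isLinear.Build F {mpoly F[n]} {mpoly F[n]} _ (poisson omega f)
    (poisson_linearr f).

Lemma poissonDl f g h : {{f + g, h}} = {{f, h}} + {{g, h}}.
Proof.
rewrite /poisson -big_split; apply: eq_bigr => i _ /=.
rewrite -big_split; apply: eq_bigr => j _ /=.
by rewrite mderivD mulrDl scalerDr.
Qed.

Lemma poisson0l g : {{0, g}} = 0.
Proof.
by rewrite /poisson big1 // => i _; rewrite big1 // => j _;
  rewrite mderiv0 mul0r scaler0.
Qed.

Lemma poisson_suml (I : Type) (r : seq I) (p : pred I) (h : I -> {mpoly F[n]}) g :
  {{\sum_(i <- r | p i) h i, g}} = \sum_(i <- r | p i) {{h i, g}}.
Proof.
apply: (big_morph (fun f => {{f, g}})) => [f1 f2|]; last exact: poisson0l.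
exact: poissonDl.
Qed.

Lemma poisson_sumr (I : Type) (r : seq I) (p : pred I) f (g : I -> {mpoly F[n]}) :
  {{f, \sum_(i <- r | p i) g i}} = \sum_(i <- r | p i) {{f, g i}}.
Proof. exact: linear_sum. Qed.

Lemma poissonMr f g h : {{f, g * h}} = {{f, g}} * h + g * {{f, h}}.
Proof.
rewrite /poisson mulr_suml mulr_sumr -big_split; apply: eq_bigr => i _ /=.
rewrite mulr_suml mulr_sumr -big_split; apply: eq_bigr => j _ /=.
by rewrite mderivM mulrDr scalerDr -scalerAl -scalerAr mulrA (mulrCA g).
Qed.

Lemma poissonC f c : {{f, c%:MP}} = 0.
Proof.
by rewrite /poisson big1 // => i _; rewrite big1 // => j _;
  rewrite mderivC mulr0 scaler0.
Qed.

Lemma poissonXr f g k : {{f, g ^+ k.+1}} = k.+1%:R *: (g ^+ k * {{f, g}}).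
Proof.
elim: k => [|k ih]; first by rewrite expr1 expr0 mul1r scale1r.
rewrite exprS poissonMr ih [_ * g ^+ _]mulrC -scalerAr mulrA -exprS.
by rewrite -[X in X + _]scale1r -scalerDl -natr1 addrC natr1 -[in RHS]natr1 addrC.
Qed.

Lemma poisson_homog d e f g : f \is d.-homog -> g \is e.-homog ->
  {{f, g}} \is (d.-1 + e.-1).-homog.
Proof.
move=> hf hg; apply: rpred_sum => i _; apply: rpred_sum => j _.
by apply/rpredZ/dhomogM; apply: dhomog_mderiv.
Qed.

Lemma skewC u w : omega u w = - omega w u.
Proof. by rewrite hermC /= expr1 mulN1r. Qed.

Lemma linfun_omega w : linfun (omega w : V -> F^o) =1 omega w.
Proof. by apply: linear_linfunE => c x y; rewrite linearPr. Qed.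

Lemma flatE w u : flat omega w u = omega w u.
Proof.
rewrite /flat (linear_linfunE _ w) ?linfun_omega // => c x y.
apply/lfunP => z; rewrite add_lfunE scale_lfunE !linfun_omega.
by rewrite linearDl linearZl_LR.
Qed.

Hypothesis nondeg : nondegenerate omega.

Lemma nondegenerateP u : (forall w, omega u w = 0) -> u = 0.
Proof.
move=> u0; apply/eqP; rewrite -memv0 -(eqP nondeg).
by apply/mem_orthovP => w _.
Qed.

(** Nondegeneracy makes [flat] injective, and equality of dimensions makes it surjective. Its
    generalised inverse is therefore a right inverse on the whole dual space. *)
Lemma sharpE xi u : omega (sharp omega xi) u = xi u.
Proof.
rewrite -flatE /sharp limg_lfunVK //.
suff /eqP -> : limg (flat omega) == fullv by rewrite memvf.
have ker0 : lker (flat omega) == 0%VS.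
  apply/lker0P => x y exy.
  apply/eqP; rewrite -subr_eq0; apply/eqP/nondegenerateP => w.
  by rewrite linearBl /= -!flatE exy subrr.
rewrite eqEdim subvf /= limg_dim_eq; first by rewrite !dimvf /dim /= muln1.
by rewrite (eqP ker0) capv0.
Qed.

(** The coefficient of the [i]-th partial derivative is [omega] between [sharp (coordf i)] and
    [sharp xi], which is the [i]-th coordinate of [sharp xi]. This is the link between brackets and
    the generators of [J_]. *)
Lemma poisson_linpoly f xi : {{f, linpoly xi}} = dirderiv (sharp omega xi) f.
Proof.
have sharp_sum : sharp omega xi =
    \sum_(j < n) (xi b`_j : F) *: sharp omega (coordf j).
  by rewrite /sharp {1}[xi]dual_coord_sum linear_sum; apply: eq_bigr => j _;
    rewrite linearZ.
apply: eq_bigr => i _.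
rewrite -coordfE -sharpE sharp_sum linear_sumr /= scaler_suml.
apply: eq_bigr => j _; rewrite mderiv_linpoly mulrC mul_mpolyC scalerA.
by congr (_ *: _); rewrite linearZr_LR /= mulrC.
Qed.

End Poisson.

(** * The Lagrangian splitting, the embedding of GL(X), and the invariant quadratic function *)

Section LagrangianTheory.
Variables (F : fieldType) (V : vectType F) (omega : {skew_symmetric V}).
Variables X Y : {vspace V}.
Hypotheses (nondeg : nondegenerate omega) (lagX : lagrangian omega X)
  (lagY : lagrangian omega Y) (addXY : (X + Y)%VS = {:V}%VS)
  (capXY : (X :&: Y)%VS = 0%VS).
Implicit Types (f g h : {mpoly F[\dim {:V}]}) (xi : dual V) (u w : V).
Local Notation n := (\dim {:V}).
Local Notation b := (vbasis {:V}).
Local Notation Q := (daddv_pi X Y).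
Local Notation P := (daddv_pi Y X).

Let capYX : (Y :&: X)%VS = 0%VS. Proof. by rewrite capvC. Qed.

Lemma projYX_add u : P u + Q u = u.
Proof. by rewrite daddv_pi_add ?capYX // addvC addXY memvf. Qed.

Lemma projX_id u : u \in X -> Q u = u. Proof. exact: daddv_pi_id. Qed.
Lemma projY_id u : u \in Y -> P u = u. Proof. exact: daddv_pi_id. Qed.

Lemma projX_eq0 u : u \in Y -> Q u = 0.
Proof.
by move=> uY; apply: (@addrI _ u); rewrite -{1}(projY_id uY) projYX_add addr0.
Qed.

Lemma projY_eq0 u : u \in X -> P u = 0.
Proof.
by move=> uX; apply: (@addIr _ u); rewrite -{2}(projX_id uX) projYX_add add0r.
Qed.

Lemma isotropicX u w : u \in X -> w \in X -> omega u w = 0.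
Proof. by rewrite -{1}lagX => /mem_orthovP; apply. Qed.

Lemma isotropicY u w : u \in Y -> w \in Y -> omega u w = 0.
Proof. by rewrite -{1}lagY => /mem_orthovP; apply. Qed.

Lemma annihilator_projY xi : annihilator Y xi -> (xi \o P = 0)%VF.
Proof.
by move=> xiY; apply/lfunP => u; rewrite comp_lfunE xiY ?memv_pi // lfunE.
Qed.

Lemma pairingE y x : pairing omega X Y y x = omega (vsval x) (vsval y).
Proof.
have E z : linfun (fun x => omega (vsval x) (vsval z) : F^o) =1
    (fun x : subvs_of X => omega (vsval x) (vsval z)).
  by apply: linear_linfunE => c x1 x2; rewrite linearP linearDl linearZl_LR.
rewrite /pairing linear_linfunE ?E // => c y1 y2; apply/lfunP => x1.
by rewrite add_lfunE scale_lfunE !E linearP.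
Qed.

(** Extend [phi] by zero on [Y] to a form [xi] on [V]. The vector [sharp xi] is then orthogonal to
    [Y], hence lies in [Y], and represents [phi] up to sign. *)
Lemma pairing_surj phi : phi \in limg (pairing omega X Y).
Proof.
pose xi : dual V := linfun (fun u : V => phi (vsproj X (Q u)) : F^o).
have xiE u : xi u = phi (vsproj X (Q u)).
  by rewrite /xi linear_linfunE // => c x y; rewrite !linearP.
pose w := sharp omega xi.
have wY : w \in Y.
  rewrite -lagY; apply/mem_orthovP => y yY.
  by rewrite sharpE // xiE projX_eq0 // !linear0.
(* The sign appears because [pairing] puts the vector of [Y] in the second argument of [omega],
   whereas [sharpE] has it in the first. *)
suff -> : phi = pairing omega X Y (vsproj Y (- w)) by apply: memv_img (memvf _).
apply/lfunP => x; rewrite pairingE vsprojK ?rpredN // linearNr /= -skewC.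
by rewrite sharpE // xiE projX_id ?subvsP // vsvalK.
Qed.

(** Surjectivity of [pairing] lets its generalised inverse cancel, and what remains is [A^-1]
    applied to [A x]. *)
Lemma contragredientE (A : 'End(subvs_of X)) (x : subvs_of X)
    (y : subvs_of Y) :
  lker A = 0%VS ->
  omega (vsval (A x)) (vsval (contragredient omega A y)) =
  omega (vsval x) (vsval y) :> F.
Proof.
move=> kerA; rewrite -[LHS]pairingE /contragredient limg_lfunVK ?pairing_surj //.
by rewrite comp_lfunE pairingE lker0_lfunK //; apply/eqP.
Qed.

Lemma GL_embedE (A : 'End(subvs_of X)) u : GL_embed omega Y A u =
  vsval (A (vsproj X (Q u))) +
  vsval (contragredient omega A (vsproj Y (P u))).
Proof.
rewrite /GL_embed linear_linfunE // => c x y.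
rewrite !linearP /contragredient linearP comp_lfunDl -comp_lfunZl !linearP.
by rewrite scalerDr addrACA.
Qed.

Lemma projX_GL_embed (A : 'End(subvs_of X)) u :
  Q (GL_embed omega Y A u) = vsval (A (vsproj X (Q u))).
Proof.
by rewrite GL_embedE linearD /= (projX_id (subvsP _)) (projX_eq0 (subvsP _)) addr0.
Qed.

Lemma projY_GL_embed (A : 'End(subvs_of X)) u :
  P (GL_embed omega Y A u) =
  vsval (contragredient omega A (vsproj Y (P u))).
Proof.
by rewrite GL_embedE linearD /= (projY_eq0 (subvsP _)) (projY_id (subvsP _)) add0r.
Qed.

Definition euler_form u w : F := omega (Q u) (P w).

Lemma euler_form_GL (A : 'End(subvs_of X)) u w : lker A = 0%VS ->
  euler_form (GL_embed omega Y A u) (GL_embed omega Y A w) = euler_form u w.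
Proof.
move=> kerA; rewrite /euler_form projX_GL_embed projY_GL_embed.
by rewrite contragredientE // !vsprojK ?memv_pi.
Qed.

Lemma euler_form_suml (a : 'I_n -> F) (e : 'I_n -> V) w :
  euler_form (\sum_i a i *: e i) w = \sum_i a i * euler_form (e i) w.
Proof.
rewrite /euler_form linear_sum linear_sumlz; apply: eq_bigr => i _.
by rewrite linearZ linearZl_LR.
Qed.

Lemma euler_form_sumr (a : 'I_n -> F) (e : 'I_n -> V) w :
  euler_form w (\sum_i a i *: e i) = \sum_i a i * euler_form w (e i).
Proof.
rewrite /euler_form linear_sum linear_sumr; apply: eq_bigr => i _.
by rewrite linearZ linearZr_LR.
Qed.

(* The quadratic function [u |-> omega (Q u) (P u)]: its bracket with a function
   of bidegree [(p, q)] is the multiplication by [q - p]. *)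
Definition euler_ham : {mpoly F[n]} :=
  \sum_(i < n) \sum_(j < n) euler_form b`_i b`_j *: ('X_i * 'X_j).

(** The pullback has as coefficient of ['X_k * 'X_l] the value of [euler_form] at the images of the
    [k]-th and [l]-th basis vectors, so invariance of the bilinear form suffices. *)
Lemma pullback_euler_ham (A : 'End(subvs_of X)) : lker A = 0%VS ->
  pullback (GL_embed omega Y A) euler_ham = euler_ham.
Proof.
move=> kerA; set g := GL_embed omega Y A.
have -> : pullback g euler_ham = \sum_(i < n) \sum_(j < n) \sum_(k < n) \sum_(l < n)
    (euler_form b`_i b`_j * (coord b i (g b`_k) * coord b j (g b`_l)))
      *: ('X_k * 'X_l).
  rewrite linear_sum; apply: eq_bigr => i _.
  rewrite linear_sum; apply: eq_bigr => j _.
  rewrite linearZ /= pullbackM !pullbackX mulr_suml scaler_sumr.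
  apply: eq_bigr => k _; rewrite mulr_sumr scaler_sumr; apply: eq_bigr => l _.
  by rewrite !comp_lfunE !coordfE -scalerAl -scalerAr !scalerA mulrA.
(* The sums over [k] and [l] are moved outside, leaving the expansion of [euler_form] in coordinates
   inside. *)
rewrite (eq_bigr _ (fun i _ => exchange_big _ _ _ _ _ _)) /= exchange_big.
apply: eq_bigr => k _.
rewrite (eq_bigr _ (fun i _ => exchange_big _ _ _ _ _ _)) /= exchange_big.
apply: eq_bigr => l _.
rewrite -(@euler_form_GL A) // -/g {2}[g b`_k]coord_sum {2}[g b`_l]coord_sum.
rewrite euler_form_suml scaler_suml; apply: eq_bigr => i _.
rewrite euler_form_sumr mulr_sumr scaler_suml; apply: eq_bigr => j _.
by rewrite mulrCA [coord b j _ * _]mulrC mulrCA.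
Qed.

(** With [w] the vector of [xi], the bracket is the derivative along [w] of a quadratic function,
    namely the sum of its bilinear form with [w] in either slot. Isotropy of [Y] and of [X] turns
    the two terms into [xi (P u)] and [- xi (Q u)]. *)
Lemma poisson_euler_ham xi : poisson omega euler_ham (linpoly xi) =
  linpoly (xi \o P)%VF - linpoly (xi \o Q)%VF.
Proof.
rewrite poisson_linpoly //; set w := sharp omega xi.
have form1 u : euler_form w u = xi (P u).
  rewrite -(sharpE nondeg) -/w -{2}[w]projYX_add linearDl /=.
  by rewrite (@isotropicY (P w)) ?memv_pi // add0r.
have form2 u : euler_form u w = - xi (Q u).
  rewrite -(sharpE nondeg) -/w -skewC -{2}[w]projYX_add linearDr /=.
  by rewrite (@isotropicX _ (Q w)) ?memv_pi // addr0.
have -> : dirderiv w euler_ham =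
    \sum_(i < n) euler_form w b`_i *: 'X_i + \sum_(i < n) euler_form b`_i w *: 'X_i.
  rewrite linear_sum.
  have -> : \sum_(i < n) euler_form w b`_i *: 'X_i =
      \sum_(i < n) \sum_(j < n)
        (coord b i w * euler_form b`_i b`_j) *: ('X_j : {mpoly F[n]}).
    rewrite exchange_big; apply: eq_bigr => j _.
    by rewrite {1}[w]coord_sum euler_form_suml scaler_suml.
  rewrite -big_split; apply: eq_bigr => i _ /=.
  rewrite [in euler_form b`_i w](coord_sum w) euler_form_sumr scaler_suml.
  rewrite linear_sum -big_split.
  apply: eq_bigr => j _ /=; rewrite linearZ /= dirderivM !dirderivX !coordfE.
  rewrite mul_mpolyC ['X_i * _]mulrC mul_mpolyC scalerDr !scalerA.
  by rewrite mulrC [in X in _ + X]mulrC.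
rewrite /linpoly -sumrB -big_split; apply: eq_bigr => i _ /=.
by rewrite form1 form2 !comp_lfunE scaleNr.
Qed.

End LagrangianTheory.

(** * Concentration of the quotient by brackets in balanced bidegrees *)

Section HP0Bound.
Variables (F : numFieldType) (V : vectType F) (omega : {skew_symmetric V}).
Variables X Y : {vspace V}.
Hypotheses (nondeg : nondegenerate omega) (lagX : lagrangian omega X)
  (lagY : lagrangian omega Y) (addXY : (X + Y)%VS = {:V}%VS)
  (capXY : (X :&: Y)%VS = 0%VS).
Variable G : seq 'End(subvs_of X).
Hypothesis subG : finite_subgroup_GL G.
Implicit Types (f g h : {mpoly F[\dim {:V}]}) (xi : dual V) (u w : V).
Local Notation n := (\dim {:V}).
Local Notation b := (vbasis {:V}).
Local Notation Q := (daddv_pi X Y).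
Local Notation P := (daddv_pi Y X).
Local Notation B := (bracket_span omega Y G).
Local Notation part_Y := (weight_part P Q).
Local Notation "{{ f , g }}" := (poisson omega f g).

Let PQ : forall u, P u + Q u = u := projYX_add addXY capXY.

(** The bracket with [euler_ham] plus the Euler operator is a derivation that doubles the forms
    vanishing on [X] and kills those vanishing on [Y]. It thus measures twice the degree in the dual
    of [Y], without reference to the other degree. *)
Lemma poisson_euler_part_Y j f :
  {{euler_ham omega X Y, part_Y j f}} + \sum_(i < n) 'X_i * (part_Y j f)^`M(i)
  = (j.*2)%:R *: part_Y j f.
Proof.
pose D f := {{euler_ham omega X Y, f}} + \sum_(i < n) 'X_i * f^`M(i).
have D_add f1 f2 : D (f1 + f2) = D f1 + D f2.
  rewrite /D linearD /= addrACA; congr (_ + _); rewrite -big_split.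
  by apply: eq_bigr => i _; rewrite /= mderivD mulrDr.
have D0 : D 0 = 0.
  by rewrite /D linear0 add0r big1 // => i _; rewrite mderiv0 mulr0.
have D_mul f1 f2 : D (f1 * f2) = D f1 * f2 + f1 * D f2.
  rewrite /D poissonMr mulrDl mulrDr addrACA; congr (_ + _).
  rewrite mulr_suml mulr_sumr -big_split; apply: eq_bigr => i _ /=.
  exact: var_mul_mderivM.
have DC c : D c%:MP = 0.
  by rewrite /D poissonC add0r big1 // => i _; rewrite mderivC mulr0.
have D_lin xi : D (linpoly xi) = 2%:R *: linpoly (xi \o P)%VF.
  rewrite /D (poisson_euler_ham nondeg lagX lagY addXY capXY).
  rewrite (euler_identity (linpoly_homog xi)) scale1r.
  by rewrite -[in X in _ + X](linpoly_PQ PQ xi) addrCA subrK scaler_nat mulr2n.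
rewrite -/(D _); move: f j.
apply: mpoly_alg_ind => [c|i|f1 f2 ih1 ih2|f1 f2 ih1 ih2] j.
- by rewrite weight_partC; case: eqP => [->|_]; rewrite ?DC ?D0 ?scaler0 ?scale0r.
- rewrite -linpoly_coordf weight_part_linpoly.
  (* [D] sends a linear form to twice its composite with [P]. Hence idempotence of [P] gives the
     eigenvalue 2 for [j = 1], and vanishing of [P] after [Q] in the composite form gives 0 for
     [j = 0]. *)
  have PP : (P \o P = P)%VF.
    by apply/lfunP => u; rewrite comp_lfunE (projY_id capXY) ?memv_pi.
  have QP : (Q \o P = 0)%VF.
    apply/lfunP => u.
    by rewrite comp_lfunE (projX_eq0 addXY capXY) ?memv_pi ?lfunE.
  case: eqP => [->|_]; last case: eqP => [->|_].
  + by rewrite D_lin -comp_lfunA QP comp_lfun0r linear0 scaler0 scale0r.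
  + by rewrite D_lin -comp_lfunA PP.
  by rewrite D0 scaler0.
- by rewrite linearD /= D_add scalerDr; congr (_ + _); [apply: ih1|apply: ih2].
rewrite weight_partM.
rewrite (big_morph D D_add D0) scaler_sumr; apply: eq_bigr => i _ /=.
rewrite D_mul ih1 ih2 -scalerAl -scalerAr -scalerDl -natrD -doubleD.
by rewrite subnKC // -ltnS.
Qed.

Lemma invariants_pihomog d h :
  invariants omega Y G h -> invariants omega Y G (pihomog mdeg d h).
Proof. by move=> hG A AG; rewrite -pihomog_pullback hG. Qed.

Lemma invariants_euler_ham : invariants omega Y G (euler_ham omega X Y).
Proof.
case: subG => _ _ subGV A /subGV [kerA _]; exact: pullback_euler_ham.
Qed.

Lemma mem_bracket_span h g : invariants omega Y G h -> B {{h, g}}.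
Proof. by move=> hG; apply: mem_span; exists h => //; exists g. Qed.

(** The part is an eigenvector of the bracket with [euler_ham] for the eigenvalue [2j - d], which is
    invertible in characteristic zero. *)
Lemma bracket_span_part_Y j d f : f \is d.-homog -> j.*2 != d ->
  B (part_Y j f).
Proof.
move=> hf jd; have := poisson_euler_part_Y j f.
rewrite (euler_identity (weight_part_homog P Q j hf)).
move/(canRL (addrK _)); rewrite -scalerBl => E.
have nz : (j.*2)%:R - d%:R != 0 :> F by rewrite subr_eq0 eqr_nat.
have -> : part_Y j f = ((j.*2)%:R - d%:R)^-1 *: {{euler_ham omega X Y, part_Y j f}}.
  by rewrite E scalerA mulVf // scale1r.
exact/spanZ/mem_bracket_span/invariants_euler_ham.
Qed.

Lemma bracket_span_odd d f : f \is d.-homog -> odd d -> B f.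
Proof.
move=> hf oddd; rewrite (weight_part_sum PQ f); apply: span_sum => j _.
apply: bracket_span_part_Y hf _; apply: contraTneq oddd => <-.
by rewrite odd_double.
Qed.

Lemma bracket_span_even q f : f \is (q.*2).-homog -> B (f - part_Y q f).
Proof.
move=> hf.
have off j : j != q -> B (part_Y j f).
  by move=> jq; apply: bracket_span_part_Y hf _; rewrite (inj_eq double_inj).
(* If [q] is beyond the size, the part of index [q] is the default coefficient 0, and all parts that
   occur lie in the span of brackets. *)
have [qs|sq] := ltnP q (size (weight_mor P Q f)).
  rewrite {1}(weight_part_sum PQ f) (bigD1 (Ordinal qs)) //= addrAC subrr add0r.
  by apply: span_sum => j; apply: off.
have -> : part_Y q f = 0 by rewrite /weight_part nth_default.
rewrite subr0 (weight_part_sum PQ f); apply: span_sum => j _; apply: off.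
by rewrite ltn_eqF // (leq_trans (ltn_ord j)).
Qed.

(** Both arguments of a bracket can be split into homogeneous components, those of the invariant one
    staying invariant, and each resulting bracket is homogeneous. *)
Lemma bracket_span_pihomog d f : B f -> B (pihomog mdeg d f).
Proof.
move: f; apply: (span_ind (T := [set f | B (pihomog mdeg d f)])) => /=.
- by rewrite linear0; apply: span0.
- by move=> f g Bf Bg; rewrite linearD; apply: spanD.
- by move=> c f Bf; rewrite linearZ; apply: spanZ.
move=> _ [h hG [g _ <-]].
rewrite [h](pihomog_partitionE (leqnn (mmeasure mdeg h))) poisson_suml linear_sum.
apply: span_sum => i _.
rewrite [g](pihomog_partitionE (leqnn (mmeasure mdeg g))) poisson_sumr linear_sum.
apply: span_sum => j _ /=.
have hom := poisson_homog omega (pihomogP mdeg i h) (pihomogP mdeg j g).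
have [<-|ne] := eqVneq (i.-1 + j.-1)%N d.
  by rewrite (pihomog_dE hom); apply/mem_bracket_span/invariants_pihomog.
by rewrite (pihomog_ne0 ne hom); apply: span0.
Qed.

(** * Agreement of the parts with the grading defined by products of linear forms *)

Lemma bidegreeM p q p' q' f g : bidegree X Y p q f -> bidegree X Y p' q' g ->
  bidegree X Y (p + p') (q + q') (f * g).
Proof.
move=> bf bg; move: f bf.
apply: (span_ind (T := [set f | bidegree X Y (p + p') (q + q') (f * g)])) => /=.
- by rewrite mul0r; apply: span0.
- by move=> f1 f2 b1 b2; rewrite mulrDl; apply: spanD.
- by move=> c f1 b1; rewrite -scalerAl; apply: spanZ.
move=> f [xi [eta [xiY etaX ->]]]; move: g bg.
apply: (span_ind (T := [set g | bidegree X Y (p + p') (q + q') (_ * g)])) => /=.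
- by rewrite mulr0; apply: span0.
- by move=> f1 f2 b1 b2; rewrite mulrDr; apply: spanD.
- by move=> c f1 b1; rewrite -scalerAr; apply: spanZ.
move=> g [xi' [eta' [xiY' etaX' ->]]]; rewrite mulrACA; apply: mem_span.
exists (fun i => match split i with inl j => xi j | inr j => xi' j end).
exists (fun i => match split i with inl j => eta j | inr j => eta' j end).
split=> [i|i|]; [by case: split|by case: split|].
rewrite !big_split_ord /=; congr (_ * _ * (_ * _)); apply: eq_bigr => i _.
- by rewrite (unsplitK (inl _ i)).
- by rewrite (unsplitK (inr _ i)).
- by rewrite (unsplitK (inl _ i)).
by rewrite (unsplitK (inr _ i)).
Qed.

Lemma bidegree_degree_Y p q f : bidegree X Y p q f -> degree_Y X Y q f.
Proof. by move=> bf; apply: mem_span; exists p. Qed.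

Lemma degree_YM q q' f g :
  degree_Y X Y q f -> degree_Y X Y q' g -> degree_Y X Y (q + q') (f * g).
Proof.
move=> bf bg; move: f bf.
apply: (span_ind (T := [set f | degree_Y X Y (q + q') (f * g)])) => /=.
- by rewrite mul0r; apply: span0.
- by move=> f1 f2 b1 b2; rewrite mulrDl; apply: spanD.
- by move=> c f1 b1; rewrite -scalerAl; apply: spanZ.
move=> f [p _ bf]; move: g bg.
apply: (span_ind (T := [set g | degree_Y X Y (q + q') (f * g)])) => /=.
- by rewrite mulr0; apply: span0.
- by move=> f1 f2 b1 b2; rewrite mulrDr; apply: spanD.
- by move=> c f1 b1; rewrite -scalerAr; apply: spanZ.
by move=> g [p' _ bg]; apply: bidegree_degree_Y (bidegreeM bf bg).
Qed.

(** Checked on constants and variables, then propagated by the convolution formula for parts of a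
    product. *)
Lemma degree_Y_part_Y q f : degree_Y X Y q (part_Y q f).
Proof.
move: f q; apply: mpoly_alg_ind => [c|i|f1 f2 ih1 ih2|f1 f2 ih1 ih2] q.
- rewrite weight_partC; case: eqP => [->|_]; last exact: span0.
  rewrite -[c%:MP]mulr1 mul_mpolyC; apply/spanZ/(@bidegree_degree_Y 0)/mem_span.
  exists (fun=> 0), (fun=> 0); split; [by case|by case|].
  by rewrite !big_ord0 mulr1.
- rewrite -linpoly_coordf weight_part_linpoly.
  case: eqP => [->|_]; last case: eqP => [->|_]; last exact: span0.
    apply/(@bidegree_degree_Y 1)/mem_span.
    exists (fun=> (coordf i \o Q)%VF), (fun=> 0); split=> [_|[]//|].
      by move=> u uY; rewrite comp_lfunE (projX_eq0 addXY capXY) ?linear0.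
    by rewrite big_ord1 big_ord0 mulr1.
  apply/(@bidegree_degree_Y 0)/mem_span.
  exists (fun=> 0), (fun=> (coordf i \o P)%VF); split=> [[]//|_|].
    by move=> u uX; rewrite comp_lfunE (projY_eq0 addXY capXY) ?linear0.
  by rewrite big_ord1 big_ord0 mul1r.
- by rewrite linearD; apply: spanD; [apply: ih1|apply: ih2].
rewrite weight_partM; apply: span_sum => j _.
have := degree_YM (ih1 j) (ih2 (q - j)%N).
by rewrite subnKC // -ltnS.
Qed.

(** * Comparison of the ideal of [v] with the brackets, through powers of [v] *)

Variable v : dual V.
Hypothesis annv : annihilator Y v.
Local Notation J := (J_ omega Y G v).
Local Notation L := (linpoly v).

(** The generators may be taken homogeneous, because components of invariants are invariant. This
    later separates elements of different total degree modulo [J]. *)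
Lemma J_pihomog d f : J f -> J (pihomog mdeg d f).
Proof.
move: f; apply: (ideal_ind (T := [set f | J (pihomog mdeg d f)])) => /=.
- by rewrite linear0; apply: ideal0.
- by move=> f g Jf Jg; rewrite linearD; apply: idealD.
move=> a _ [h hG <-].
rewrite [h](pihomog_partitionE (leqnn (mmeasure mdeg h))) linear_sum mulr_sumr linear_sum.
apply: ideal_sum => i _.
rewrite [a](pihomog_partitionE (leqnn (mmeasure mdeg a))) mulr_suml linear_sum.
apply: ideal_sum => j _ /=.
have hom := dhomogM (pihomogP mdeg j a)
  (dirderiv_homog (sharp omega v) (pihomogP mdeg i h)).
have [<-|ne] := eqVneq (j + i.-1)%N d.
  rewrite pihomog_dE //; apply: mem_ideal.
  by exists (pihomog mdeg i h) => //; apply: invariants_pihomog.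
by rewrite (pihomog_ne0 ne hom); apply: ideal0.
Qed.

Lemma linpoly_exp_homog k : L ^+ k \is k.-homog.
Proof. by rewrite -[X in X.-homog]mul1n; apply/dhomogMn/linpoly_homog. Qed.

Lemma part_Y_linpoly_exp k j f : part_Y j (L ^+ k * f) = L ^+ k * part_Y j f.
Proof.
apply: weight_part_mull; rewrite rmorphXn /= weight_mor_linpoly_id ?rmorphXn //.
exact: annihilator_projY.
Qed.

(* For [h] invariant, [{h, L^(k+1) a} = (k+1) L^k a D_{v'} h + L^(k+1) {h, a}]. *)
Lemma J_reduction k f : J f -> exists r, B (L ^+ k * f + L ^+ k.+1 * r).
Proof.
move: f; apply: (ideal_ind (T := [set f | exists r, B (L ^+ k * f + L ^+ k.+1 * r)])).
- by exists 0; rewrite !mulr0 addr0; apply: span0.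
- move=> f g [r Br] [s Bs]; exists (r + s).
  by rewrite !mulrDr addrACA; apply: spanD.
move=> a _ [h hG <-]; exists (k.+1%:R^-1 *: {{h, a}}).
suff -> : L ^+ k * (a * dirderiv (sharp omega v) h) +
    L ^+ k.+1 * (k.+1%:R^-1 *: {{h, a}}) = k.+1%:R^-1 *: {{h, L ^+ k.+1 * a}}.
  exact/spanZ/mem_bracket_span.
rewrite poissonMr poissonXr poisson_linpoly // scalerDr -!scalerAl scalerA.
by rewrite mulVf ?pnatr_eq0 // scale1r -scalerAr -!mulrA [a * _]mulrC.
Qed.

(** A graded form of [J_reduction]: with [d = p + q] the exponent is [k = q - p], so everything
    happens in bidegree [(q, q)]. The remainder [r] has total degree one less, that is, one less
    factor vanishing on [Y]. *)
Lemma J_reduction_homog q d k f : (d + k)%N = q.*2 -> f \is d.-homog ->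
  J (part_Y q f) -> exists r,
    (if d is e.+1 then r \is e.-homog else r = 0) /\
    B (L ^+ k * part_Y q f - L ^+ k.+1 * part_Y q r).
Proof.
move=> dk hf /(J_reduction k) [r /(bracket_span_pihomog q.*2)].
rewrite linearD /= (pihomog_mull _ _ (linpoly_exp_homog k.+1)).
rewrite pihomog_dE; last first.
  rewrite -dk addnC; apply: dhomogM (linpoly_exp_homog k) _.
  exact: weight_part_homog.
(* For [d = 0] the factor [L ^+ k.+1] already has degree above [2q], so the correction term has no
   component there. *)
case: d dk hf => [|d] dk hf; rewrite -dk.
  rewrite add0n ltnn addr0 => Bf; exists 0; split=> //.
  by rewrite linear0 mulr0 subr0.
rewrite addSnnS leq_addl addnK => Br; exists (- pihomog mdeg d r).
have hr := pihomogP mdeg d r; split; first by rewrite dhomogN.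
(* Modulo brackets, the correction term may be replaced by its part of degree [q] in the dual of
   [Y]. *)
have := bracket_span_even (q := q) (f := L ^+ k.+1 * pihomog mdeg d r).
rewrite part_Y_linpoly_exp -dk addSnnS addnC => /(_ (dhomogM (linpoly_exp_homog _) hr)).
move/(spanB Br); rewrite opprB -addrA [X in B (_ + X) -> _]addrC subrK.
by rewrite linearN mulrN opprK.
Qed.

Lemma JZ c f : J f -> J (c *: f).
Proof. by move=> Jf; rewrite -mul_mpolyC; apply: idealM. Qed.

Lemma part_Y_sum q m (a : 'I_m -> F) (g : 'I_m -> {mpoly F[n]}) :
  part_Y q (\sum_i a i *: g i) = \sum_i a i *: part_Y q (g i).
Proof. by rewrite linear_sum; apply: eq_bigr => i _; rewrite linearZ. Qed.

(** Induction down the filtration by total degree; [D] is one more than the degree of the family, so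
    that [D = 0] stands for the zero family. Combinations independent modulo [J] are kept, while
    those falling into [J] are traded for elements of lower degree with one more factor [L]. The
    length of the family is preserved. *)
Lemma filtration_step q D k m (g : 'I_m -> {mpoly F[n]}) :
  (D + k)%N = (q.*2).+1 ->
  (forall i, if D is d.+1 then g i \is d.-homog else g i = 0) ->
  independent_mod B (fun i => L ^+ k * part_Y q (g i)) ->
  exists g' : 'I_m -> {mpoly F[n]},
    (forall i, exists2 d, (d < D)%N & g' i \is d.-homog) /\
    independent_mod J (fun i => part_Y q (g' i)).
Proof.
elim: D k m g => [|d IH] k m g dk gP indB.
  (* An independent family of zeros is empty: with all coefficients 1, a nonempty one would give a
     relation. *)
  case: m g gP indB => [|m] g gP indB; first by exists g; split=> [[]//|a _ []].
  suff /indB/(_ ord0)/eqP :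
      B (\sum_(i < m.+1) (fun=> 1) i *: (L ^+ k * part_Y q (g i))).
    by rewrite oner_eq0.
  rewrite big1 => [|i _]; first exact: span0.
  by rewrite gP linear0 mulr0 scaler0.
have [r [s [A [C [rs freeA freeC indA JC]]]]] :=
  rank_split (ideal0 _) (@idealD _ _) JZ (fun i => part_Y q (g i)).
pose gC i := \sum_(j < m) C i j *: g j; pose gA i := \sum_(j < m) A i j *: g j.
have hom_gA i : gA i \is d.-homog by apply: rpred_sum => j _; apply/rpredZ/gP.
have /choice [g1 g1P] : forall i : 'I_s, exists x,
    (if d is e.+1 then x \is e.-homog else x = 0) /\
    B (L ^+ k * part_Y q (gC i) - L ^+ k.+1 * part_Y q x).
  move=> i; apply: (@J_reduction_homog _ d).
  - by move: dk; rewrite addSn => -[].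
  - by apply: rpred_sum => j _; apply/rpredZ/gP.
  by rewrite part_Y_sum; apply: JC.
(* Modulo [B] the new elements coincide with the combinations [gC] multiplied by [L ^+ k], and these
   are independent because the rows of [C] are. *)
have indC : independent_mod B (fun i => L ^+ k.+1 * part_Y q (g1 i)).
  move=> a Ba; apply: (independent_mod_mx freeC indB).
  rewrite (_ : \sum_i _ = \sum_i a i *: (L ^+ k * part_Y q (gC i) -
      L ^+ k.+1 * part_Y q (g1 i)) + \sum_i a i *: (L ^+ k.+1 * part_Y q (g1 i))).
    by apply: spanD => //; apply: span_sum => i _; apply/spanZ/(g1P i).2.
  rewrite -big_split; apply: eq_bigr => i _ /=.
  rewrite -scalerDr subrK part_Y_sum mulr_sumr; congr (_ *: _).
  by apply: eq_bigr => j _; rewrite -scalerAr.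
have dk' : (d + k.+1)%N = q.*2.+1 by rewrite addnS -addSn.
have [g2 [g2P indg2]] := IH _ _ g1 dk' (fun i => (g1P i).1) indC.
rewrite -rs; exists (fun i => match split i with inl j => gA j | inr j => g2 j end).
split=> [i|a].
  case: split => j; first by exists d.
  by have [e ed he] := g2P j; exists e => //; apply: leq_trans ed _.
rewrite big_split_ord /=.
under eq_bigr do rewrite (unsplitK (inl _ _)).
under [X in _ + X]eq_bigr do rewrite (unsplitK (inr _ _)).
move=> Ja.
(* The component of degree [d] of a relation involves only the [gA], since every [g2] has smaller
   degree; it stays in [J] because [J] is graded. *)
have a_l : forall j, a (lshift s j) = 0.
  apply: indA.
  rewrite (_ : \sum_i _ = pihomog mdeg d (\sum_i a (lshift s i) *: part_Y q (gA i)
      + \sum_i a (rshift r i) *: part_Y q (g2 i))); first exact: J_pihomog.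
  rewrite linearD !linear_sum /= [X in _ + X]big1 ?addr0 => [|j _].
    apply: eq_bigr => j _; rewrite linearZ /= pihomog_dE.
      by rewrite part_Y_sum.
    exact: weight_part_homog.
  have [e ed he] := g2P j; rewrite linearZ /= (@pihomog_ne0 _ _ _ e) ?scaler0 //.
    by rewrite ltn_eqF.
  exact: weight_part_homog.
have a_r : forall j, a (rshift r j) = 0.
  apply: indg2; move: Ja; rewrite big1 ?add0r // => j _.
  by rewrite a_l scale0r.
by move=> i; case: (split_ordP i) => j ->; rewrite ?a_l ?a_r.
Qed.

(** The filtration argument starts at total degree [2q] with exponent 0, after replacing each [f i]
    by its part of degree [q], which is congruent to it modulo brackets. *)
Lemma HP0_dimension_bound q m (f : 'I_m -> {mpoly F[n]}) :
  (forall i, f i \is (q.*2).-homog) -> independent_mod B f ->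
  exists f' : 'I_m -> {mpoly F[n]},
    (forall i, degree_Y X Y q (f' i)) /\ independent_mod J f'.
Proof.
move=> homf indf; have [|||g [_ indg]] := @filtration_step q q.*2.+1 0 m f.
- by rewrite addn0.
- exact: homf.
- move=> a Ba; apply: indf; rewrite (_ : \sum_i _ =
      \sum_i a i *: (f i - part_Y q (f i)) + \sum_i a i *: (L ^+ 0 * part_Y q (f i))).
    apply: spanD => //; apply: span_sum => i _; apply/spanZ.
    exact: bracket_span_even.
  rewrite -big_split; apply: eq_bigr => i _ /=.
  by rewrite -scalerDr mul1r subrK.
by exists (fun i => part_Y q (g i)); split=> // i; apply: degree_Y_part_Y.
Qed.

End HP0Bound.

End Polynomials.
Import Polynomials.

From mathcomp Require Import classical_sets reals constructive_ereal.
From mathcomp Require Import boolp ereal.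

Local Open Scope ring_scope.
Local Open Scope complex_scope.

(** * From independent families to Hilbert series and top degrees *)

Section QuotientDimension.
Variables (R : realType) (F : fieldType) (M : lmodType F).
Implicit Types A N : set M.

Lemma quotient_dim_ge0 A N : (0 <= quotient_dim R A N)%E.
Proof.
apply: ereal_sup_ubound; exists 0, (fun=> 0).
by split=> [[]//|a _ []//|].
Qed.

(** The dimension is a supremum over lengths of independent families, so comparing finite families
    also covers infinite dimensions. *)
Lemma quotient_dim_le A N A' N' :
  (forall n (f : 'I_n -> M), (forall i, A (f i)) -> independent_mod N f ->
    exists f' : 'I_n -> M, (forall i, A' (f' i)) /\ independent_mod N' f') ->
  (quotient_dim R A N <= quotient_dim R A' N')%E.
Proof.
move=> H; apply: ge_ereal_sup => _ [n [f [Af indf ->]]].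
have [f' [Af' indf']] := H n f Af indf.
by apply: ereal_sup_ubound; exists n, f'.
Qed.

Lemma quotient_dim_sub A N : (forall x, A x -> N x) -> quotient_dim R A N = 0%E.
Proof.
move=> AN; apply/eqP; rewrite eq_le quotient_dim_ge0 andbT.
apply: ge_ereal_sup => _ [[|n] [f [Af indf ->]]] //.
suff /indf/(_ ord0)/eqP : N (\sum_(i < n.+1) (i == ord0)%:R *: f i).
  by rewrite eqxx oner_eq0.
rewrite big_ord_recl eqxx scale1r big1 ?addr0 => [|i _]; first exact/AN/Af.
by rewrite scale0r.
Qed.

End QuotientDimension.

(** A nonzero coefficient of [h1] must sit at an even index [i] with [h2] nonzero at [i./2]:
    otherwise the bound is 0 and nonnegativity forces the coefficient to vanish. *)
Lemma top_degree_series_sq (R : realType) (h1 h2 : nat -> \bar R) :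
  (forall i, 0 <= h1 i)%E -> series_le h1 (series_sq h2) ->
  (top_degree h1 <= 2%:R%:E * top_degree h2)%E.
Proof.
move=> h1_ge0 le12; apply: ge_ereal_sup => _ [i h1i <-].
have := le12 i; rewrite /series_sq; case: ifP => [_|oddi] le1.
  by case/negP: h1i; rewrite eq_le h1_ge0 andbT.
have -> : (i%:R%:E = 2%:R%:E * (i./2)%:R%:E :> \bar R)%E.
  by rewrite -EFinM -natrM mul2n -[in LHS](odd_double_half i) oddi.
apply: lee_wpmul2l => //; apply: ereal_sup_ubound; exists i./2 => //.
by apply: contraNneq h1i => h2i /=; rewrite eq_le h1_ge0 andbT -h2i.
Qed.

Theorem theorem3p1 (R : realType) (V : vectType R[i])
    (omega : {skew_symmetric V}) (X Y : {vspace V})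
    (G : seq 'End(subvs_of X)) :
  nondegenerate omega ->
  {:V}%VS != 0%VS ->
  lagrangian omega X -> lagrangian omega Y ->
  (X + Y)%VS = {:V}%VS -> (X :&: Y)%VS = 0%VS ->
  finite_subgroup_GL G ->
  forall v : dual V, annihilator Y v ->
    series_le (HP0_hilbert omega Y G R)
              (series_sq (R_Y_hilbert omega Y G R v))
    /\ (top_degree (HP0_hilbert omega Y G R)
        <= 2%:R%:E * top_degree (R_Y_hilbert omega Y G R v))%E.
Proof.
move=> nondeg _ lagX lagY addXY capXY subG v annv.
have le_h : series_le (HP0_hilbert omega Y G R)
                      (series_sq (R_Y_hilbert omega Y G R v)).
  move=> d; rewrite /series_sq; case: ifP => oddd.
    (* In odd degree there is no balanced bidegree, so every polynomial is a combination of
       brackets. *)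
    rewrite [HP0_hilbert _ _ _ _ _]quotient_dim_sub // => f hf.
    exact: (bracket_span_odd nondeg lagX lagY addXY capXY subG hf oddd).
  apply: quotient_dim_le => m f hf indf.
  apply: (HP0_dimension_bound nondeg lagX lagY addXY capXY subG annv) indf.
  by move=> i; have := hf i; rewrite -[in total_degree d](odd_double_half d) oddd.
split=> //; apply: top_degree_series_sq le_h => d; exact: quotient_dim_ge0.
Qed.
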